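(* Let $d<\infty$, let $V\subset\mathbb{B}_d$ be an analytic disc attached to the unit sphere and $f$ its embedding map. Then for every $s<0$, $\mathcal{H}_s\neq\mathcal{H}_f$.
   Context: $\mathbb{D}$ is the open unit disc, $\mathbb{B}_d$ the open unit ball of $\mathbb{C}^d$. For $s\in\mathbb{R}$, $\mathcal{H}_s=\{h(z)=\sum_{n\ge0}a_nz^n:\ \sum_{n\ge0}(1+n)^{-s}|a_n|^2<\infty\}$. The Drury–Arveson space $H^2_d$ is the RKHS on $\mathbb{B}_d$ with kernel $1/(1-\langle z,w\rangle)$, with multiplier algebra $\mathcal{M}_d$. A variety is a common zero set in $\mathbb{B}_d$ of a family of functions from $\mathcal{M}_d$. An analytic disc attached to the unit sphere is a variety $V\subset\mathbb{B}_d$ ($d<\infty$) for which there is an injective analytic $f:\mathbb{D}\to\mathbb{B}_d$ with $f'(z)\neq0$ on $\mathbb{D}$, $V=f(\mathbb{D})$, $f$ extends to a $C^2$ map on $\overline{\mathbb{D}}$, and for $x\in\overline{\mathbb{D}}$, $\|f(x)\|=1$ iff $|x|=1$ ($f$ is the embedding map). $\mathcal{H}_f$ is the RKHS on $\mathbb{D}$ with kernel $k^f(z,w)=1/(1-\langle f(z),f(w)\rangle)$. Spaces are compared as sets of functions on $\mathbb{D}$. *)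

(* Defs.v *)
From HB Require Import structures.
From mathcomp Require Import all_boot all_order all_algebra.
From mathcomp Require Import all_classical all_reals all_analysis.
From mathcomp Require Import complex.
Set Implicit Arguments. Unset Strict Implicit. Unset Printing Implicit Defensive.
Import Order.TTheory GRing.Theory Num.Theory numFieldNormedType.Exports.
Local Open Scope ring_scope.
Local Open Scope classical_set_scope.

Section Defs.
Variable R : realType.
Local Notation C := R[i].

Definition dotC (d : nat) (z w : 'rV[C]_d) : C := \sum_(i < d) z 0 i * (w 0 i)^*.

Definition enorm (d : nat) (z : 'rV[C]_d) : C := sqrtC (dotC z z).

Definition unit_disc : set C := [set z : C | `|z| < 1].
Definition closed_unit_disc : set C := [set z : C | `|z| <= 1].
Definition unit_ball (d : nat) : set 'rV[C]_d := [set z | enorm z < 1].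

(* Membership in the reproducing kernel Hilbert space H(K) on the set [Om]
   with kernel K(z,w) (K(.,w) = k_w).  By Aronszajn's theorem, h belongs to
   H(K) iff h is bounded on the span of the kernel functions, i.e. there is
   M >= 0 with  |sum_i c_i h(w_i)|^2 <= M * || sum_i conj(c_i) k_{w_i} ||^2
   = M * sum_{i,j} conj(c_i) c_j K(w_j, w_i)  for all finite families. *)
Definition in_RKHS (X : Type) (Om : set X) (K : X -> X -> C) (h : X -> C) :=
  exists M : C, 0 <= M /\
    forall (n : nat) (w : 'I_n -> X) (c : 'I_n -> C),
      (forall i, Om (w i)) ->
      `| \sum_(i < n) c i * h (w i) | ^+ 2 <=
        M * \sum_(i < n) \sum_(j < n) (c i)^* * c j * K (w j) (w i).

Definition DA_kernel (d : nat) (z w : 'rV[C]_d) : C := (1 - dotC z w)^-1.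
Definition in_DA (d : nat) (h : 'rV[C]_d -> C) :=
  in_RKHS (@unit_ball d) (@DA_kernel d) h.

Definition multiplier (d : nat) (phi : 'rV[C]_d -> C) :=
  forall h, in_DA h -> in_DA (fun z => phi z * h z).

Definition variety (d : nat) (V : set 'rV[C]_d) :=
  exists S : set ('rV[C]_d -> C), (forall phi, S phi -> multiplier phi) /\
    V = [set z | unit_ball z /\ forall phi, S phi -> phi z = 0].

Definition in_Hs (s : R) (h : C -> C) :=
  exists a : nat -> C,
    (forall z, unit_disc z ->
       series (fun n => (a n * z ^+ n : C^o)) @ \oo --> (h z : C^o)) /\
    cvg (series (fun n => (Complex (powR (n.+1)%:R (- s)) 0 * `|a n| ^+ 2 : C^o)) @ \oo).

Definition in_Hf (d : nat) (f : C -> 'rV[C]_d) (h : C -> C) :=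
  in_RKHS unit_disc (fun z w => (1 - dotC (f z) (f w))^-1) h.

Definition pdx (g : R -> R -> R) : R -> R -> R :=
  fun x y => (fun t => g t y)^`() x.
Definition pdy (g : R -> R -> R) : R -> R -> R :=
  fun x y => (fun t => g x t)^`() y.

Definition C1_on (U : set (R * R)) (g : R -> R -> R) :=
  forall p : R * R, U p ->
    [/\ derivable (fun t => g t p.2) p.1 1,
        derivable (fun t => g p.1 t) p.2 1,
        {for p, continuous (fun q : R * R => g q.1 q.2)},
        {for p, continuous (fun q : R * R => pdx g q.1 q.2)} &
        {for p, continuous (fun q : R * R => pdy g q.1 q.2)}].

Definition C2_on (U : set (R * R)) (g : R -> R -> R) :=
  C1_on U g /\ C1_on U (pdx g) /\ C1_on U (pdy g).

Definition C2_map_on (d : nat) (U : set (R * R)) (F : C -> 'rV[C]_d) :=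
  forall i : 'I_d,
    C2_on U (fun x y => complex.Re (F (Complex x y) 0 i)) /\
    C2_on U (fun x y => complex.Im (F (Complex x y) 0 i)).

Definition extends_C2 (d : nat) (f : C -> 'rV[C]_d) (F : C -> 'rV[C]_d) :=
  (forall z, unit_disc z -> F z = f z) /\
  exists U : set (R * R), open U /\
    (forall x y : R, closed_unit_disc (Complex x y) -> U (x, y)) /\
    C2_map_on U F.

(* V is an analytic disc attached to the unit sphere with embedding map f;
   the extension F gives the values of f on the closed disc *)
Definition attached_disc (d : nat) (V : set 'rV[C]_d) (f : C -> 'rV[C]_d) :=
  variety V /\
  (forall z, unit_disc z -> derivable (f : C^o -> 'rV[C]_d) z 1) /\
  (forall z w, unit_disc z -> unit_disc w -> f z = f w -> z = w) /\
  (forall z, unit_disc z -> 'D_1 (f : C^o -> 'rV[C]_d) z != 0) /\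
  V = f @` unit_disc /\
  exists F : C -> 'rV[C]_d, extends_C2 f F /\
    (forall x, closed_unit_disc x -> (enorm (F x) = 1 <-> `|x| = 1)).

End Defs.

(* Main.v *)
Require Import Defs.
From mathcomp Require Import all_boot all_order all_algebra.
From mathcomp Require Import all_classical all_reals all_analysis.
From mathcomp Require Import complex.
From mathcomp Require Import ring lra.
Import Order.TTheory GRing.Theory Num.Theory numFieldNormedType.Exports.
Local Open Scope ring_scope.
Local Open Scope classical_set_scope.

(** The kernel of H_f on the diagonal is 1 / (1 - |f(z)|^2), and since f is
    differentiable up to the boundary point 1 it is at least c / (1 - r) at
    z = r < 1.  The kernel of H_s, s < 0, is o(1 / (1 - r)) there, so point
    evaluations at r are much larger on H_f than on H_s.  A function that
    witnesses this is h = sum_m 2^-m k_m / |k_m|, where k_m is the kernel of H_f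
    at a point r_m tending to 1 fast: all values of the kernel of H_f have
    positive real part, so |h(r_m)| >= 2^-m |k_m| whatever the other terms are,
    which exceeds the growth allowed in H_s. *)

Set Implicit Arguments.
Unset Strict Implicit.
Local Open Scope complex_scope.

(** * Order and limits in [R[i]], reduced to real and imaginary parts *)

Section ComplexLimits.
Variable R : realType.
Local Notation C := R[i].
Implicit Types (x y : C) (u : nat -> C^o).

Lemma ReB x y : complex.Re (x - y) = complex.Re x - complex.Re y.
Proof. by case: x y => [a b] [c e]. Qed.

Lemma ImB x y : complex.Im (x - y) = complex.Im x - complex.Im y.
Proof. by case: x y => [a b] [c e]. Qed.

Lemma normc_Re x : `|x| = (complex.Re `|x|)%:C.
Proof. by rewrite RRe_real // ger0_real. Qed.

Lemma le_normRe x (e : R) : `|x| <= e%:C -> `|complex.Re x| <= e.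
Proof. by move=> h; rewrite -lecR (le_trans (normc_ge_Re x)). Qed.

Lemma le_normIm x (e : R) : `|x| <= e%:C -> `|complex.Im x| <= e.
Proof.
move=> h; rewrite -normrN -ReiNIm; apply: le_normRe.
by rewrite normrM complexiE normCi mulr1.
Qed.

Lemma norm_le_ReIm x : `|x| <= (`|complex.Re x| + `|complex.Im x|)%:C.
Proof.
rewrite {1}[x]complexE (le_trans (ler_normD _ _)) // normrM complexiE normCi.
by rewrite mul1r !normc_def /= !expr0n /= !addr0 !sqrtr_sqr raddfD.
Qed.

(** The nonnegative reals are closed in the complex plane. In the order of [R[i]], being nonnegative
    includes being real, so the imaginary part needs its own estimate. *)
Lemma ge0_approx x :
  (forall e : R, 0 < e -> exists2 y, 0 <= y & `|x - y| <= e%:C) -> 0 <= x.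
Proof.
move=> H; rewrite lecE /=; apply/andP; split.
  rewrite -normr_eq0 eq_le normr_ge0 andbT; apply/ler_addgt0Pr => e e0.
  have [y y0 /le_normIm] := H _ e0.
  by rewrite ImB (ger0_Im y0) subr0 add0r.
apply/ler_addgt0Pr => e e0; have [y + /le_normRe] := H _ e0.
rewrite lecE /= ReB ler_norml => /andP[_ y0] /andP[h _]; lra.
Qed.

Lemma norm_cvg_le u x y : u @ \oo --> (x : C^o) ->
  (forall n, `|u n| <= y) -> `|x| <= y.
Proof.
move=> /cvgrPdist_le ux uy; have y0 : 0 <= y by apply: le_trans (uy 0).
rewrite -subr_ge0; apply: ge0_approx => e e0.
have ec0 : 0 < e%:C by rewrite ltcR.
have [N _ /(_ N (leqnn _)) /= hN] := ux _ ec0.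
(* This is [y - |x|] moved up by [e]; it is nonnegative because [u N] lies within [e] of [x] and has
   modulus at most [y]. *)
exists (y + e%:C - `|x|).
  rewrite subr_ge0 -[x](subrK (u N)) (le_trans (ler_normD _ _)) //.
  by rewrite addrC lerD.
by rewrite opprB addrA subrK opprD addrA subrr add0r normrN gtr0_norm.
Qed.

Lemma Re_cvg_ge u x (b : R) : u @ \oo --> (x : C^o) ->
  (\forall n \near \oo, b <= complex.Re (u n)) -> b <= complex.Re x.
Proof.
move=> /cvgrPdist_le ux ub; apply/ler_addgt0Pr => e e0.
have ec0 : 0 < e%:C by rewrite ltcR.
have [N _ /(_ N (leqnn _)) /= []] := filterI (ux _ ec0) ub.
by move=> /le_normRe; rewrite ReB ler_norml => /andP[h _] h'; lra.
Qed.

(** Real and imaginary parts are dominated by a geometric series, hence converge absolutely over the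
    reals; the two limits are then recombined. *)
Lemma is_cvg_series_half (u : nat -> C) (B : R) :
  (forall n, `|u n| <= (B * 2^-1 ^+ n)%:C) ->
  cvgn (series (u : nat -> C^o)).
Proof.
move=> uB; have B0 : 0 <= B.
  by have := le_trans (normr_ge0 _) (uB 0); rewrite expr0 mulr1 ler0c.
have geo : cvgn (series (geometric B (2^-1 : R))).
  by apply: is_cvg_geometric_series; rewrite ger0_norm // invf_lt1 // ltr1n.
have abs (v : R^nat) : (forall n, `|v n| <= B * 2^-1 ^+ n) -> cvgn (series v).
  move=> vB; apply: normed_cvg; apply: (series_le_cvg _ _ _ geo) => n;
    [exact: normr_ge0| |exact: vB].
  by apply: mulr_ge0 => //; apply: exprn_ge0.
have /cvg_ex[/= a /cvgrPdist_le ca] : cvgn (series (fun n => complex.Re (u n))).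
  by apply: abs => n; apply: le_normRe.
have /cvg_ex[/= b /cvgrPdist_le cb] : cvgn (series (fun n => complex.Im (u n))).
  by apply: abs => n; apply: le_normIm.
apply/cvg_ex; exists (Complex a b : C^o); apply/cvgrPdist_le => e e0.
have [r r0 ->] : exists2 r : R, 0 < r & e = r%:C.
  exists (complex.Re e); last by rewrite RRe_real // gtr0_real.
  by move: e0; rewrite ltcE => /andP[].
have r20 : 0 < r / 2 by rewrite divr_gt0.
apply: (filterS _ (filterI (ca _ r20) (cb _ r20))) => n [ha hb].
apply: (le_trans (norm_le_ReIm _)).
rewrite lecR [leRHS](splitr r); apply: lerD.
  by move: ha; rewrite ReB /series /=
    (raddf_sum (@complex.Re R : Rcomplex R -> R)).
by move: hb; rewrite ImB /series /=
  (raddf_sum (@complex.Im R : Rcomplex R -> R)).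
Qed.

End ComplexLimits.

(** * The Drury-Arveson kernel: bounds, positivity, Cauchy-Schwarz *)

Section Kernels.
Variables (R : realType) (d : nat).
Local Notation C := R[i].
Implicit Types a b : 'rV[C]_d.

Lemma dotC_conj a b : (dotC a b)^*%R = dotC b a.
Proof.
rewrite /dotC rmorph_sum; apply: eq_bigr => i _.
by rewrite rmorphM /= conjCK mulrC.
Qed.

Lemma dotC_ge0 a : 0 <= dotC a a.
Proof. by apply: sumr_ge0 => i _; rewrite mul_conjC_ge0. Qed.

Lemma unit_ballE a : unit_ball a = (dotC a a < 1) :> Prop.
Proof. by rewrite /unit_ball /= /enorm rootC_lt1 // dotC_ge0. Qed.

(** Arithmetic-geometric mean inequality in each coordinate. This form serves in place of
    Cauchy-Schwarz, since two points of the ball already make the right side less than 1. *)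
Lemma norm_dotC_le a b : `|dotC a b| <= (dotC a a + dotC b b) / 2.
Proof.
rewrite (le_trans (ler_norm_sum _ _ _)) // /dotC -big_split mulr_suml /=.
apply: ler_sum => i _; rewrite normrM norm_conjC -!normCK.
rewrite ler_pdivlMr // -subr_ge0.
have -> : `|a 0 i| ^+ 2 + `|b 0 i| ^+ 2 - `|a 0 i| * `|b 0 i| * 2 =
  (`|a 0 i| - `|b 0 i|) ^+ 2 by ring.
by rewrite -realEsqr rpredB // ger0_real.
Qed.

Lemma norm_dotC_lt1 a b : unit_ball a -> unit_ball b -> `|dotC a b| < 1.
Proof.
rewrite !unit_ballE => a1 b1; apply: le_lt_trans (norm_dotC_le a b) _.
by rewrite ltr_pdivrMr // mul1r -[ltRHS]/(1 + 1) ltrD.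
Qed.

Lemma subr1_dotC_neq0 a b : unit_ball a -> unit_ball b -> 1 - dotC a b != 0.
Proof.
move=> ha hb; rewrite subr_eq0; apply/eqP => h.
by have := norm_dotC_lt1 ha hb; rewrite -h normr1 ltxx.
Qed.

Lemma DA_kernel_conj a b : (DA_kernel a b)^*%R = DA_kernel b a.
Proof. by rewrite /DA_kernel fmorphV rmorphB rmorph1 /= dotC_conj. Qed.

Lemma DA_kernel_diag_gt0 a : unit_ball a -> 0 < DA_kernel a a.
Proof. by rewrite unit_ballE => a1; rewrite invr_gt0 subr_gt0. Qed.

(** The bound is uniform in [b], so it dominates a series of kernel functions at varying points,
    evaluated at a fixed [a]. *)
Lemma norm_DA_kernel_le a b : unit_ball a -> unit_ball b ->
  `|DA_kernel a b| <= 2 / (1 - dotC a a).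
Proof.
move=> ha hb; have nab := norm_dotC_le a b.
move: (ha) (hb); rewrite !unit_ballE => a1 b1.
have da : 0 < 1 - dotC a a by rewrite subr_gt0.
have h : (1 - dotC a a) / 2 <= `|1 - dotC a b|.
  apply: le_trans (lerB_dist _ _); rewrite normr1 lerBrDr.
  apply: le_trans (lerD (lexx _) nab) _.
  rewrite -mulrDl addrA subrK ler_pdivrMr // mul1r -[leRHS]/(1 + 1) lerD //.
  exact: ltW.
rewrite /DA_kernel normfV -[2 / _]invrK invf_div lef_pV2 ?posrE //.
  by rewrite normr_gt0 subr1_dotC_neq0.
by rewrite divr_gt0.
Qed.

(** [1 - dotC a b] lies in the right half plane, which inversion preserves. *)
Lemma Re_DA_kernel_ge0 a b : unit_ball a -> unit_ball b ->
  0 <= complex.Re (DA_kernel a b).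
Proof.
move=> /norm_dotC_lt1 H /H {H} h; rewrite /DA_kernel.
have : `|complex.Re (dotC a b)| <= complex.Re `|dotC a b|.
  by apply: le_normRe; rewrite -normc_Re.
have : complex.Re `|dotC a b| < 1 by move: h; rewrite ltcE => /andP[].
case: (dotC a b) => [x y] /= h1 h2.
apply: divr_ge0; last by rewrite addr_ge0 ?sqr_ge0.
rewrite subr_ge0; apply: le_trans (ler_norm _) _.
by apply: le_trans h2 _; apply: ltW.
Qed.

(** A case of the Schur product theorem. One factor [dotC] is expanded in coordinates and the
    coordinates are absorbed into the coefficients, which lowers the power by one; for power 0 the
    form is the squared modulus of the sum of the [c i]. *)
Lemma dotC_pow_psd k n (a : 'I_n -> 'rV[C]_d) (c : 'I_n -> C) :
  0 <= \sum_(i < n) \sum_(j < n) (c i)^*%R * c j * dotC (a j) (a i) ^+ k.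
Proof.
elim: k c => [|k IH] c.
  suff -> : \sum_(i < n) \sum_(j < n) (c i)^*%R * c j * dotC (a j) (a i) ^+ 0 =
    (\sum_i c i) * (\sum_i c i)^*%R by exact: mul_conjC_ge0.
  rewrite mulrC rmorph_sum mulr_suml; apply: eq_bigr => i _.
  by rewrite mulr_sumr; apply: eq_bigr => j _; rewrite expr0 mulr1.
suff -> : \sum_(i < n) \sum_(j < n) (c i)^*%R * c j * dotC (a j) (a i) ^+ k.+1 =
  \sum_(l < d) \sum_(i < n) \sum_(j < n)
    (c i * a i 0 l)^*%R * (c j * a j 0 l) * dotC (a j) (a i) ^+ k.
  by apply: sumr_ge0 => l _; apply: (IH (fun i => c i * a i 0 l)).
rewrite [RHS]exchange_big; apply: eq_bigr => i _ /=.
rewrite [RHS]exchange_big; apply: eq_bigr => j _ /=.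
rewrite exprS mulrA -mulr_suml {1}/dotC mulr_sumr; congr (_ * _).
by apply: eq_bigr => l _; rewrite rmorphM /=; ring.
Qed.

(** The kernel is the geometric series in [dotC], whose partial sums give nonnegative forms. The
    remainder after [N] terms is the kernel times the [N]-th power of [dotC], so it is at most
    [B * rho ^+ N]; here [rho < 1] because there are finitely many points. *)
Lemma DA_kernel_psd n (a : 'I_n -> 'rV[C]_d) (c : 'I_n -> C) :
  (forall i, unit_ball (a i)) ->
  0 <= \sum_(i < n) \sum_(j < n) (c i)^*%R * c j * DA_kernel (a j) (a i).
Proof.
move=> ha.
pose rho := \big[Num.max/0]_(i < n) complex.Re (dotC (a i) (a i)).
have rho0 : 0 <= rho by apply: bigmax_ge_id.
have rho1 : rho < 1.
  apply/bigmax_ltP; split=> // i _.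
  by have := ha i; rewrite unit_ballE ltcE => /andP[].
have arho i : dotC (a i) (a i) <= rho%:C.
  by rewrite lecE (ger0_Im (dotC_ge0 _)) eqxx /=; apply: le_bigmax.
have arho2 i j : `|dotC (a j) (a i)| <= rho%:C.
  apply: le_trans (norm_dotC_le _ _) _; rewrite ler_pdivrMr //.
  by rewrite mulrDr mulr1 lerD.
pose B := \sum_(i < n) \sum_(j < n) `|(c i)^*%R * c j * DA_kernel (a j) (a i)|.
have B0 : 0 <= B by apply: sumr_ge0 => i _; apply: sumr_ge0.
apply: ge0_approx => e e0.
have /cvgrPdist_le /(_ _ e0) [N _ /(_ N (leqnn _)) /= hN] :
  geometric (complex.Re B) rho @ \oo --> (0 : R).
  by apply: cvg_geometric; rewrite ger0_norm.
exists (\sum_(k < N) \sum_(i < n) \sum_(j < n)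
    (c i)^*%R * c j * dotC (a j) (a i) ^+ k).
  by apply: sumr_ge0 => k _; apply: dotC_pow_psd.
have -> : \sum_(i < n) \sum_(j < n) (c i)^*%R * c j * DA_kernel (a j) (a i) -
   \sum_(k < N) \sum_(i < n) \sum_(j < n)
     (c i)^*%R * c j * dotC (a j) (a i) ^+ k =
   \sum_(i < n) \sum_(j < n)
     (c i)^*%R * c j * DA_kernel (a j) (a i) * dotC (a j) (a i) ^+ N.
  rewrite [X in _ - X]exchange_big -sumrB; apply: eq_bigr => i _ /=.
  rewrite [X in _ - X]exchange_big -sumrB; apply: eq_bigr => j _ /=.
  rewrite -mulr_sumr -mulrBr -mulrA; congr (_ * _).
  have nz := subr1_dotC_neq0 (ha j) (ha i).
  apply: (mulfI nz); rewrite mulrBr /DA_kernel mulfV // mulrA mulfV // mul1r.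
  by rewrite -(opprB (dotC _ _)) mulNr -subrX1 opprK addrC subrK.
apply: (@le_trans _ _ (B * rho%:C ^+ N)).
  rewrite /B mulr_suml (le_trans (ler_norm_sum _ _ _)) //.
  apply: ler_sum => i _.
  rewrite mulr_suml (le_trans (ler_norm_sum _ _ _)) //.
  apply: ler_sum => j _.
  by rewrite normrM ler_wpM2l // normrX lerXn2r // nnegrE ?ler0c.
rewrite -(RRe_real (ger0_real B0)) -rmorphXn -rmorphM lecR.
by move: hN; rewrite sub0r normrN; apply: le_trans; apply: ler_norm.
Qed.

(** Positivity is applied to the points [a i] together with [b], as in the usual discriminant
    argument. *)
Lemma DA_kernel_CauchySchwarz n (a : 'I_n -> 'rV[C]_d) (c : 'I_n -> C) b :
  (forall i, unit_ball (a i)) -> unit_ball b ->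
  `|\sum_(i < n) c i * DA_kernel (a i) b| ^+ 2 <=
   (\sum_(i < n) \sum_(j < n) (c i)^*%R * c j * DA_kernel (a j) (a i))
     * DA_kernel b b.
Proof.
move=> ha hb; set u := (X in `|X|); set Q := (X in X * _).
have kb := DA_kernel_diag_gt0 hb.
(* This coefficient of [b] minimises the enlarged form; the minimum is [Q] minus the squared modulus
   of [u] over [DA_kernel b b]. *)
pose t := - u / DA_kernel b b.
pose a' (i : 'I_n.+1) := if unlift ord0 i is Some j then a j else b.
pose c' (i : 'I_n.+1) := if unlift ord0 i is Some j then c j else t.
have ha' i : unit_ball (a' i) by rewrite /a'; case: unlift.
have := @DA_kernel_psd n.+1 a' c' ha'.
have l0 (T : Type) (x : 'I_n -> T) y :
    (if unlift ord0 (ord0 : 'I_n.+1) is Some j then x j else y) = y.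
  by rewrite unlift_none.
have lS (T : Type) (x : 'I_n -> T) y j :
    (if unlift ord0 (lift ord0 j : 'I_n.+1) is Some j then x j else y) = x j.
  by rewrite liftK.
rewrite big_ord_recl big_ord_recl /a' /c' !l0.
under eq_bigr do rewrite !lS -mulrA.
rewrite -mulr_sumr -/u.
under [X in _ + X]eq_bigr => i _.
  rewrite big_ord_recl !l0 !lS.
  under eq_bigr do rewrite !lS.
  over.
rewrite big_split /= -/Q.
have -> : \sum_(i < n) (c i)^*%R * t * DA_kernel b (a i) = t * u^*%R.
  rewrite /u rmorph_sum mulr_sumr; apply: eq_bigr => i _.
  by rewrite rmorphM /= DA_kernel_conj; ring.
have tc : t^*%R = - u^*%R / DA_kernel b b.
  by rewrite /t rmorphM rmorphN fmorphV /= DA_kernel_conj.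
have knz : DA_kernel b b != 0 by rewrite gt_eqF.
have -> : t^*%R * t * DA_kernel b b + t^*%R * u + (t * u^*%R + Q) =
  Q - (u * u^*%R) / DA_kernel b b by rewrite tc /t; field.
by rewrite subr_ge0 ler_pdivrMr // normCK.
Qed.

End Kernels.

(** * A function with prescribed peaks, and its pullback to the disc *)

Section Superposition.
Variables (R : realType) (d : nat).
Local Notation C := R[i].

Lemma sum_half_le2 (K : numFieldType) N : \sum_(0 <= m < N) (2^-1 : K) ^+ m <= 2.
Proof.
suff -> : \sum_(0 <= m < N) (2^-1 : K) ^+ m = 2 - 2 * 2^-1 ^+ N.
  by rewrite gerBl mulr_ge0 // exprn_ge0.
elim: N => [|N IH]; first by rewrite big_geq // expr0 mulr1 subrr.
by rewrite big_nat_recr //= IH exprS mulrA mulfV // mul1r; ring.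
Qed.

(* The cross terms at [p m] cannot cancel the [m]-th term, because [DA_kernel]
   takes values in the right half plane. *)
Lemma in_DA_peaks (p : nat -> 'rV[C]_d) : (forall m, unit_ball (p m)) ->
  exists2 g : 'rV[C]_d -> C, in_DA g &
    forall m, (4^-1 ^+ m) / (1 - dotC (p m) (p m)) <= `|g (p m)| ^+ 2.
Proof.
move=> hp; pose delta m := 1 - dotC (p m) (p m).
have d0 m : 0 < delta m by rewrite subr_gt0 -unit_ballE.
have d1 m : delta m <= 1 by rewrite gerBl dotC_ge0.
(* The kernel function at [p m] has squared norm [(delta m)^-1], so [beta m] rescales it to norm
   [2^-m]. *)
pose beta m : C := 2^-1 ^+ m * sqrtC (delta m).
have b0 m : 0 <= beta m by rewrite mulr_ge0 ?exprn_ge0 // sqrtC_ge0 ltW.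
have b2 m : beta m ^+ 2 = 4^-1 ^+ m * delta m.
  by rewrite exprMn sqrtCK -exprM mulnC exprM; congr (_ ^+ _ * _); field.
pose u w m := beta m * DA_kernel w (p m).
pose g w : C := limn (series (u w : nat -> C^o)).
have ug w : unit_ball w -> series (u w : nat -> C^o) @ \oo --> (g w : C^o).
  move=> hw; have w1 := hw; rewrite unit_ballE in w1.
  have B0 : 0 <= 2 / (1 - dotC w w) by rewrite divr_ge0 // subr_ge0 ltW.
  apply: (@is_cvg_series_half _ _ (complex.Re (2 / (1 - dotC w w)))) => m.
  rewrite rmorphM /= RRe_real ?ger0_real // mulrC rmorphXn fmorphV rmorph_nat.
  rewrite normrM ler_pM //; last exact: norm_DA_kernel_le.
  rewrite ger0_norm // /beta ler_piMr ?exprn_ge0 //.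
  by rewrite rootC_le1 // ltW.
exists g.
  (* The terms have norms [2^-m], which sum to at most 2; [4] is the square of this bound on the
     norm of [g]. *)
  exists 4; split=> // n w c hw.
  set Q := (X in 4 * X); have Q0 : 0 <= Q by apply: DA_kernel_psd.
  suff h : `|\sum_(i < n) c i * g (w i)| <= 2 * sqrtC Q.
    have -> : 4 * Q = (2 * sqrtC Q) ^+ 2 by rewrite exprMn sqrtCK -natrX.
    by rewrite lerXn2r // nnegrE mulr_ge0 // sqrtC_ge0.
  have cv : (fun N => \sum_(i < n) c i * series (u (w i)) N : C^o) @ \oo -->
            (\sum_(i < n) c i * g (w i) : C^o).
    apply: cvg_big => [|i _]; first exact: add_continuous.
    apply: cvgM; first exact: cvg_cst.
    exact: ug (hw i).
  apply: (norm_cvg_le cv) => N.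
  have -> : \sum_(i < n) c i * series (u (w i)) N =
    \sum_(0 <= m < N) beta m * \sum_(i < n) c i * DA_kernel (w i) (p m).
    under eq_bigr do rewrite /series /= mulr_sumr.
    rewrite exchange_big; apply: eq_bigr => m _; rewrite mulr_sumr.
    by apply: eq_bigr => i _; rewrite /u; ring.
  apply: le_trans (ler_norm_sum _ _ _) _.
  apply: le_trans (_ : \sum_(0 <= m < N) 2^-1 ^+ m * sqrtC Q <= _); last first.
    by rewrite -mulr_suml ler_wpM2r ?sqrtC_ge0 // sum_half_le2.
  apply: ler_sum => m _.
  rewrite -(@ler_pXn2r _ 2) ?nnegrE // ?mulr_ge0 ?exprn_ge0 ?sqrtC_ge0 //.
  rewrite normrM !exprMn sqrtCK (ger0_norm (b0 m)) b2.
  have -> : (2^-1 ^+ m) ^+ 2 = 4^-1 ^+ m :> C.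
    by rewrite -exprM mulnC exprM; congr (_ ^+ _); field.
  rewrite -mulrA ler_wpM2l ?exprn_ge0 //.
  (* The factor [(delta m)^-1] produced here cancels the [delta m] in the square of [beta m]. *)
  have := DA_kernel_CauchySchwarz c hw (hp m).
  have -> : DA_kernel (p m) (p m) = (delta m)^-1 by [].
  by rewrite ler_pdivlMr // mulrC.
move=> m.
have bR k : beta k = (complex.Re (beta k))%:C by rewrite RRe_real ?ger0_real.
have bR0 k : 0 <= complex.Re (beta k) by rewrite -ler0c -bR.
have Re_u k w : complex.Re (u w k) =
    complex.Re (beta k) * complex.Re (DA_kernel w (p k)).
  by rewrite /u {1}bR; case: DA_kernel => x y /=; rewrite mul0r subr0.
have um0 : 0 <= u (p m) m by rewrite mulr_ge0 // ltW // DA_kernel_diag_gt0.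
have umg : u (p m) m <= `|g (p m)|.
  rewrite -(RRe_real (ger0_real um0)).
  apply: le_trans (normc_ge_Re _); rewrite lecR; apply: le_trans (ler_norm _).
  (* The [N]-th partial sum runs over indices below [N], so it contains the [m]-th term from
     [N = m.+1] on. *)
  apply: (Re_cvg_ge (ug _ (hp m))); exists m.+1 => // N /= mN.
  rewrite /series /= (raddf_sum (@complex.Re R : Rcomplex R -> R)) big_mkord.
  rewrite (bigD1 (Ordinal mN)) //= lerDl sumr_ge0 // => k _.
  by rewrite Re_u mulr_ge0 // Re_DA_kernel_ge0.
apply: le_trans (_ : u (p m) m ^+ 2 <= _); last first.
  by rewrite lerXn2r // nnegrE.
rewrite exprMn b2 /DA_kernel -/(delta m).
have dn0 : delta m != 0 by rewrite gt_eqF.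
by move: (4^-1 ^+ m) => x; rewrite le_eqVlt; apply/orP; left; apply/eqP; field.
Qed.

(** The kernel of H_f is the pullback of [DA_kernel] along [f], so the constant [M] for [g] also
    serves for [g \o f]. *)
Lemma in_Hf_comp (f : C -> 'rV[C]_d) g :
  (forall z, unit_disc z -> unit_ball (f z)) -> in_DA g -> in_Hf f (g \o f).
Proof.
move=> fB [M [M0 HM]]; exists M; split=> // n w c hw.
by apply: (HM n (f \o w) c) => i; apply: fB.
Qed.

End Superposition.

(** * Radial growth of functions in H_s for negative [s] *)

Section Growth.
Variable R : realType.
Local Notation C := R[i].
Implicit Types (s r e eta : R).

Lemma powR_nat_small s e : s < 0 -> 0 < e ->
  (* The threshold e^(1/s) chosen below solves x^s = e, and x^s decreases in x. *)
  exists N, forall n, (N <= n)%N -> n.+1%:R `^ s <= e.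
Proof.
move=> s0 e0; exists (Num.bound (e `^ s^-1)) => n Nn.
have h : e `^ s^-1 <= n.+1%:R.
  apply: ltW; apply: lt_le_trans (archi_boundP (powR_ge0 _ _)) _.
  by rewrite ler_nat (leq_trans Nn).
have /(_ h) : e `^ s^-1 <= n.+1%:R -> (e `^ s^-1) `^ (- s) <= n.+1%:R `^ (- s).
  by apply: ge0_ler_powR; rewrite ?nnegrE ?powR_ge0 // oppr_ge0 ltW.
rewrite -powRrM mulrN mulVf ?lt_eqF // powR_inv1 ?(ltW e0) // powRN.
by rewrite lef_pV2 // posrE ?powR_gt0.
Qed.

(** The sum is a partial sum of the kernel of H_s on the diagonal at [r]. Its weights tend to 0, so
    an Abelian argument applies: finitely many terms are killed by the factor [1 - r], the others
    are at most [e / 2] times a geometric series. *)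
Lemma sum_powR_near1 s e eta : s < 0 -> 0 < e -> 0 < eta ->
  exists r, [/\ 0 < r, 1 - eta < r, r < 1 &
    forall N, (1 - r) * \sum_(0 <= n < N) n.+1%:R `^ s * r ^+ (2 * n) <= e].
Proof.
move=> s0 e0 eta0.
have e20 : 0 < e / 2 by lra.
have [N0 HN0] := powR_nat_small s0 e20.
(* [t] will be [1 - r]. The three bounds ensure [0 < r], [1 - eta < r], and that the first [N0]
   terms contribute at most [e / 2]; [N0.+1] avoids dividing by zero. *)
pose t := Num.min (2^-1) (Num.min (eta / 2) (e / (2 * N0.+1%:R))).
have N0p : 0 < 2 * N0.+1%:R :> R by rewrite mulr_gt0.
have t0 : 0 < t by rewrite !lt_min !divr_gt0 // invr_gt0 ltr0n.
have t1 : t <= 2^-1 by rewrite ge_min lexx.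
have t2 : t <= eta / 2 by rewrite !ge_min lexx orbT.
have t3 : t * N0%:R <= e / 2.
  have : t <= e / (2 * N0.+1%:R) by rewrite !ge_min lexx !orbT.
  rewrite ler_pdivlMr // => h.
  have : t * N0%:R <= t * N0.+1%:R by rewrite ler_wpM2l ?(ltW t0) // ler_nat.
  lra.
pose r := 1 - t; have r0 : 0 < r by rewrite /r; lra.
exists r; split => //; [rewrite /r; lra|rewrite /r; lra|] => N.
have -> : 1 - r = t by rewrite /r; ring.
have geo k : t * \sum_(0 <= n < k) r ^+ n <= 1.
  suff -> : t * \sum_(0 <= n < k) r ^+ n = 1 - r ^+ k.
    by rewrite gerBl exprn_ge0 // ltW.
  elim: k => [|k IH]; first by rewrite big_geq // expr0 mulr0 subrr.
  by rewrite big_nat_recr //= mulrDr IH exprS /r; ring.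
have head k : \sum_(0 <= n < k) ((n < N0)%N%:R : R) <= N0%:R.
  rewrite -natr_sum ler_nat.
  elim: k => [|k IH]; first by rewrite big_geq.
  have [kN|kN] := ltnP k N0; last first.
    by rewrite big_nat_recr //= ltnNge kN addn0.
  apply: leq_trans (_ : \sum_(0 <= n < k.+1) 1 <= _)%N.
    by apply: leq_sum => i _; case: ltnP.
  by rewrite sum_nat_const_nat subn0 muln1.
apply: le_trans (_ : t * \sum_(0 <= n < N) ((n < N0)%N%:R + e / 2 * r ^+ n) <= _).
  rewrite ler_wpM2l ?(ltW t0) //; apply: ler_sum => n _.
  have rn0 : 0 <= r ^+ n by rewrite exprn_ge0 // ltW.
  have rn1 : r ^+ n <= 1 by rewrite exprn_ile1 ?(ltW r0) //; rewrite /r; lra.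
  have r2n : r ^+ (2 * n) <= r ^+ n by rewrite mul2n -addnn exprD ler_piMr.
  have r2n0 : 0 <= r ^+ (2 * n) by rewrite exprn_ge0 // ltW.
  have [nN|nN] := ltnP n N0.
    have p1 : n.+1%:R `^ s <= 1.
      by rewrite -[leRHS](powRr0 (n.+1%:R : R)) ler_powR ?ler1n // (ltW s0).
    apply: le_trans (_ : 1 <= _).
      by rewrite mulr_ile1 ?powR_ge0 // (le_trans r2n).
    by rewrite lerDl mulr_ge0 // ltW.
  by rewrite add0r ler_pM ?powR_ge0 // HN0.
rewrite big_split /= -mulr_sumr mulrDr [leRHS]splitr; apply: lerD.
  by apply: le_trans t3; rewrite ler_wpM2l ?(ltW t0).
by rewrite mulrCA ler_piMr // ltW.
Qed.

(* [x <= (x + A B / x) / 2] is the weighted AM-GM inequality summed over [n]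
   with the weight [x / A]. *)
Lemma in_Hs_growth s (h : C -> C) : in_Hs s h ->
  exists2 A : R, 0 < A & forall r B, 0 < r -> r < 1 ->
    (forall N, \sum_(0 <= n < N) n.+1%:R `^ s * r ^+ (2 * n) <= B) ->
    `|h r%:C| ^+ 2 <= (A * B)%:C.
Proof.
case=> a [ha /cvg_seq_bounded [A0 [A0r HA0]]].
(* [A] bounds the squared H_s norm. The added 1 exceeds the bound [A0] strictly and makes [A]
   positive, so that it can be divided by. *)
have [A A_gt0 HA] : exists2 A : R, 0 < A &
    forall N, \sum_(0 <= n < N) n.+1%:R `^ (- s) * (complex.Re `|a n|) ^+ 2 <= A.
  exists (`|complex.Re A0| + 1); first by rewrite ltr_wpDl.
  move=> N; have A01 : A0 < (`|complex.Re A0| + 1)%:C.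
    by rewrite -(RRe_real A0r) ltcR (le_lt_trans (ler_norm _)) // ltrDl.
  have := HA0 _ A01 N I; rewrite /= /series /= => H.
  rewrite -lecR; apply: le_trans H; apply: le_trans (real_ler_norm _); last first.
    apply: rpred_sum => n _; rewrite ger0_real // mulr_ge0 ?exprn_ge0 //.
    by rewrite (ler0c (_ `^ _)) powR_ge0.
  rewrite rmorph_sum; apply: ler_sum => n _.
  by rewrite rmorphM rmorphXn /= -normc_Re.
exists A => // r B r0 r1 HB.
have rD : unit_disc r%:C.
  by rewrite /unit_disc /= normc_def /= expr0n addr0 sqrtr_sqr gtr0_norm // ltcR.
have cv := ha _ rD.
rewrite normc_Re -rmorphXn lecR.
set x := complex.Re `|h r%:C|.
have x0 : 0 <= x by rewrite -ler0c -normc_Re.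
have B0 : 0 <= B by have := HB 0; rewrite big_geq.
have [->|xn0] := eqVneq x 0; first by rewrite expr0n mulr_ge0 // ltW.
have {x0 xn0} x0 : 0 < x by rewrite lt_def xn0.
have key : x <= (x / A * A + (x / A)^-1 * B) / 2.
  rewrite -lecR -normc_Re; apply: (norm_cvg_le cv) => N.
  apply: le_trans (ler_norm_sum _ _ _) _.
  have lam0 : 0 < x / A by rewrite divr_gt0.
  apply: le_trans (_ : (\sum_(0 <= n < N)
     (x / A * (n.+1%:R `^ (- s) * complex.Re `|a n| ^+ 2) +
     (x / A)^-1 * (n.+1%:R `^ s * r ^+ (2 * n))) / 2)%:C <= _); last first.
    rewrite lecR -mulr_suml ler_wpM2r // big_split /= -!mulr_sumr lerD //.
      by rewrite ler_wpM2l // ltW.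
    by rewrite ler_wpM2l ?invr_ge0 // ltW.
  rewrite rmorph_sum; apply: ler_sum => n _.
  rewrite normrM normrX (_ : `|r%:C| = r%:C); last first.
    by rewrite normc_def /= expr0n addr0 sqrtr_sqr gtr0_norm.
  rewrite normc_Re -rmorphXn -rmorphM lecR.
  rewrite powRN mulnC exprM.
  have p0 : 0 < n.+1%:R `^ s :> R by rewrite powR_gt0.
  move: (complex.Re `|a n|) (r ^+ n) (n.+1%:R `^ s) p0 (x / A) lam0.
  move=> y z p p0 l l0.
  rewrite -subr_ge0.
  have -> : (l * (p^-1 * y ^+ 2) + l^-1 * (p * z ^+ 2)) / 2 - y * z =
     (l * y - p * z) ^+ 2 / (2 * l * p) by field; rewrite !gt_eqF.
  by rewrite divr_ge0 ?sqr_ge0 // !mulr_ge0 // ltW.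
move: key; rewrite divfK ?gt_eqF // invf_div.
rewrite ler_pdivlMr // => key.
have key2 : x <= A * B / x by move: key; rewrite [A / x * B]mulrAC; lra.
by rewrite expr2 -ler_pdivlMr.
Qed.

End Growth.

(** * Approach of the embedded disc to the sphere along a radius *)

Section Boundary.
Variables (R : realType).
Local Notation C := R[i].

(** Near [a] the difference quotient is within 1 of the derivative [l], which gives the constant
    [|l| + 1]. *)
Lemma derivable_lipschitz_at (g : R -> R) (a : R) : derivable g a 1 ->
  exists2 L : R, 0 < L & exists2 eta : R, 0 < eta &
    forall t, a - eta < t -> t < a -> g a - g t <= L * (a - t).
Proof.
move=> /cvg_ex[/= l /cvgrPdist_le /(_ 1 ltr01)] [eta /= eta0 H].
exists (`|l| + 1); first by rewrite ltr_wpDl.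
exists eta => // t t1 t2.
have h0 : t - a < 0 by rewrite subr_lt0.
have := H (t - a); rewrite /ball_ /= sub0r normrN ltr0_norm // opprB.
rewrite ltrBlDr -ltrBlDl lt_eqF // => /(_ t1 isT).
rewrite /GRing.scale /= mulr1 subrK => H1.
have : `|(t - a)^-1 * (g t - g a)| <= `|l| + 1.
  by rewrite -[X in `|X|](subrK l) (le_trans (ler_normD _ _)) // addrC distrC lerD2l.
rewrite normrM normfV (ltr0_norm h0) opprB.
have at0 : 0 < a - t by rewrite subr_gt0.
rewrite mulrC ler_pdivrMr // => h; apply: le_trans h.
by rewrite distrC ler_norm.
Qed.

(** On the real axis the squared norm of the extension [F] is a real function [g], differentiable at
    1 with [g 1 = 1]. The defect is therefore [g 1 - g t], which is at most linear in [1 - t]. *)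
Lemma attached_disc_defect d (V : set 'rV[C]_d) f : attached_disc V f ->
  exists2 L : R, 0 < L & exists2 eta : R, 0 < eta &
    forall t, 0 < t -> 1 - eta < t -> t < 1 ->
      1 - dotC (f t%:C) (f t%:C) <= (L * (1 - t))%:C.
Proof.
case=> _ [_ [_ [_ [_ [F [[Ff [U [_ [HU HF]]]] FS]]]]]].
pose g (t : R) :=
  \sum_(i < d) (complex.Re (F t%:C 0 i) ^+ 2 + complex.Im (F t%:C 0 i) ^+ 2).
have gE t : dotC (F t%:C) (F t%:C) = (g t)%:C.
  rewrite /g rmorph_sum; apply: eq_bigr => i _.
  by rewrite -normCK -add_Re2_Im2.
have normR (t : R) : 0 < t -> `|t%:C| = t%:C.
  by move=> t0; rewrite normc_def /= expr0n addr0 sqrtr_sqr gtr0_norm.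
have one : closed_unit_disc (1%:C : C) by rewrite /closed_unit_disc /= normR.
have g1 : g 1 = 1.
  have /FS[_ /(_ (normR 1 ltr01))] := one.
  by rewrite /enorm gE => /eqP; rewrite rootC_eq1 // => /eqP/complexI.
have dg : derivable g 1 1.
  pose re i (t : R) := complex.Re (F t%:C 0 i).
  pose im i (t : R) := complex.Im (F t%:C 0 i).
  have -> : g = \sum_(i < d) (re i ^+ 2 + im i ^+ 2).
    by apply/funext => t; rewrite fct_sumE.
  apply: derivable_sum => i.
  have [[C1 _] [C2 _]] := HF i.
  have [d1 _ _ _ _] := C1 _ (HU _ _ one).
  have [d2 _ _ _ _] := C2 _ (HU _ _ one).
  by apply: derivableD; apply: derivableX; [exact: d1|exact: d2].
have [L L0 [eta eta0 H]] := derivable_lipschitz_at dg.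
exists L => //; exists eta => // t t0 t1 t2.
have tD : unit_disc t%:C by rewrite /unit_disc /= normR // ltcR.
by rewrite -Ff // gE -[1]/(1%:C) -rmorphB lecR -{1}g1 H.
Qed.

End Boundary.

Unset Implicit Arguments.
Set Strict Implicit.
Local Close Scope complex_scope.

(** * Comparison of the two growth rates *)

Theorem theorem1p12 (R : realType) (d : nat) (V : set 'rV[R[i]]_d)
  (f : R[i] -> 'rV[R[i]]_d) :
  attached_disc V f ->
  forall s : R, s < 0 ->
    ~ (forall h : R[i] -> R[i], in_Hs s h <-> in_Hf f h).
Proof.
move=> Vf s s0 HH.
have [L L0 [eta eta0 HL]] := attached_disc_defect Vf.
have fB z : unit_disc z -> unit_ball (f z).
  move=> zD; case: Vf => [[S [_ VS]] [_ [_ [_ [Vim _]]]]].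
  have : V (f z) by rewrite Vim; exists z.
  by rewrite VS => -[].
(* The rate [8^-m] is chosen to beat the factor [4^-m] lost in the peaks of [g]. *)
have e0 m : 0 < (8^-1 : R) ^+ m by rewrite exprn_gt0.
have [r Hr] := choice (fun m => sum_powR_near1 s0 (e0 m) eta0).
have rD m : unit_disc (r m)%:C%C.
  have [r0 _ r1 _] := Hr m.
  by rewrite /unit_disc /= normc_def /= expr0n addr0 sqrtr_sqr gtr0_norm // ltcR.
have [g gDA Hg] :=
  @in_DA_peaks R d (fun m => f (r m)%:C%C) (fun m => fB _ (rD m)).
have /HH/in_Hs_growth[A A0 HA] := in_Hf_comp fB gDA.
(* The peak at [r m], the growth allowed in H_s and the linear defect combine to
   [4^-m <= L * A * 8^-m]. *)
have bound m : 2 ^+ m <= L * A.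
  have [r0 r1 r2 HS] := Hr m.
  have t0 : 0 < 1 - r m by rewrite subr_gt0.
  have up : `|g (f (r m)%:C%C)| ^+ 2 <= (A * (8^-1 ^+ m / (1 - r m)))%:C%C.
    by apply: HA => // N; rewrite ler_pdivlMr // mulrC.
  have low := Hg m; have {low up} := le_trans low up.
  have df := HL _ r0 r1 r2.
  have d0 : 0 < 1 - dotC (f (r m)%:C%C) (f (r m)%:C%C).
    by rewrite subr_gt0 -unit_ballE; apply: fB.
  rewrite ler_pdivrMr // => up.
  have B0 : 0 <= (A * (8^-1 ^+ m / (1 - r m)))%:C%C.
    by rewrite ler0c mulr_ge0 ?divr_ge0 ?exprn_ge0 // ltW.
  have := le_trans up (ler_wpM2l B0 df).
  have -> : (4^-1 ^+ m : R[i]) = (4^-1 ^+ m : R)%:C%C.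
    by rewrite rmorphXn fmorphV rmorph_nat.
  rewrite -rmorphM lecR.
  have -> : A * (8^-1 ^+ m / (1 - r m)) * (L * (1 - r m)) = L * A * 8^-1 ^+ m.
    by move: (8^-1 ^+ m) => x; field; rewrite gt_eqF.
  have p8 : 0 < (8 : R) ^+ m by rewrite exprn_gt0.
  rewrite [8^-1 ^+ m]exprVn ler_pdivlMr //; apply: le_trans.
  by rewrite -exprMn; have -> : 4^-1 * 8 = 2 :> R by field.
have LA0 : 0 <= L * A by rewrite mulr_ge0 // ltW.
(* Any [m] above [L * A] contradicts [bound m], since [m < 2 ^ m]. *)
have := archi_boundP LA0; set m := Num.bound _ => hm.
have : (m%:R : R) < 2 ^+ m by rewrite -natrX ltr_nat ltn_expl.
by have := bound m; lra.
Qed.
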